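(* Let $f:\mathbb{R}^n\times\mathbb{R}^m\to\mathbb{R}\cup\{\infty\}$ be a proper, lower semicontinuous function, let $(\bar x,\bar\lambda)\in\operatorname{dom}f$ and $\bar v\in\mathbb{R}^n$. Then $f$ is para-prox-regular in $x$ at $\bar x$ for $\bar v$ with compatible parametrization by $\lambda$ at $\bar\lambda$, with parameters $\epsilon>0$, $r>0$, if and only if $\bar v$ is a proximal subgradient of $f$ with respect to $x$ at $(\bar x,\bar\lambda)$ and $$\langle v_1-v_0,x_1-x_0\rangle\ge -r|x_1-x_0|^2$$ when for $i\in\{0,1\}$ we have $|x_i-\bar x|<\epsilon$, $|f(x_i,\lambda)-f(\bar x,\bar\lambda)|<\epsilon$, $v_i\in\partial_xf(x_i,\lambda)$, $|v_i-\bar v|<\epsilon$, and $|\lambda-\bar\lambda|<\epsilon$.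
   Context: $|\cdot|$ is the Euclidean norm. Subgradients: for $h:\mathbb{R}^n\to\mathbb{R}\cup\{\infty\}$ and $x\in\operatorname{dom}h$, $v$ is a regular subgradient ($v\in\hat\partial h(x)$) if $h(y)\ge h(x)+\langle v,y-x\rangle+o(|y-x|)$; $v$ is a subgradient ($v\in\partial h(x)$) if there are $x^\nu\to x$ with $h(x^\nu)\to h(x)$ and $v^\nu\in\hat\partial h(x^\nu)$ with $v^\nu\to v$; $v$ is a proximal subgradient of $h$ at $x$ if there are $\rho>0$ and a neighborhood of $x$ on which $h(y)\ge h(x)+\langle v,y-x\rangle-\frac{\rho}{2}|y-x|^2$. For $x\notin\operatorname{dom}h$, $\partial h(x)=\emptyset$. For $f:\mathbb{R}^n\times\mathbb{R}^m\to\mathbb{R}\cup\{\infty\}$, $\partial_xf(x,\lambda)$ is the subdifferential of $f(\cdot,\lambda)$ at $x$, and ''proximal subgradient with respect to $x$ at $(\bar x,\bar\lambda)$'' means proximal subgradient of $f(\cdot,\bar\lambda)$ at $\bar x$. A function $h$ finite at $\bar w$ is locally lsc (lower semicontinuous) at $\bar w$ if there is $\epsilon>0$ such that all sets $\{w:|w-\bar w|\le\epsilon,\ h(w)\le\alpha\}$ with $\alpha\le h(\bar w)+\epsilon$ are closed. Para-prox-regularity: a proper $f:\mathbb{R}^n\times\mathbb{R}^m\to\mathbb{R}\cup\{\infty\}$ is para-prox-regular in $x$ at $\bar x$ for $\bar v$ with compatible parametrization by $\lambda$ at $\bar\lambda$, with parameters $\epsilon>0$, $r\ge0$, if $f$ is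 locally lsc at $(\bar x,\bar\lambda)$, $\bar v\in\partial_xf(\bar x,\bar\lambda)$, and $f(x',\lambda)\ge f(x,\lambda)+\langle v,x'-x\rangle-\frac r2|x'-x|^2$ whenever $|x'-\bar x|<\epsilon$, $|x-\bar x|<\epsilon$, $|f(x,\lambda)-f(\bar x,\bar\lambda)|<\epsilon$, $v\in\partial_xf(x,\lambda)$, $|v-\bar v|<\epsilon$ and $|\lambda-\bar\lambda|<\epsilon$.
   Formalization: In the ''if'' direction, para-prox-regularity is obtained with the same r but with some ε' satisfying 0 < ε' ≤ ε in place of ε; with the same ε that direction is false. The ''only if'' direction keeps both ε and r. *)

(* Defs.v *)
(* Points of R^n are row vectors, over an arbitrary realType R. *)
From HB Require Import structures.
From mathcomp Require Import all_boot all_order all_algebra.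
From mathcomp Require Import all_classical all_reals all_analysis.

Set Implicit Arguments.
Unset Strict Implicit.
Unset Printing Implicit Defensive.

Import Order.TTheory GRing.Theory Num.Theory.
Import numFieldNormedType.Exports.

Local Open Scope classical_set_scope.
Local Open Scope ring_scope.

(* The library norm on 'rV[R]_n is the max norm, so the Euclidean norm is
   introduced by hand. Both norms induce the library topology, which is the one
   used for limits, neighbourhoods, closed sets and lower semicontinuity. *)
Definition dotv (R : realType) (n : nat) (u v : 'rV[R]_n) : R :=
  \sum_(i < n) u 0 i * v 0 i.

Definition enorm (R : realType) (n : nat) (u : 'rV[R]_n) : R :=
  Num.sqrt (dotv u u).

(* Euclidean norm of R^n x R^m, identified with R^(n+m). *)
Definition enorm2 (R : realType) (n m : nat) (w : 'rV[R]_n * 'rV[R]_m) : R :=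
  Num.sqrt (dotv w.1 w.1 + dotv w.2 w.2).

(* Functions into R \cup {oo} are \bar R-valued functions that never take the
   value -oo; the latter is part of [proper_fun]. *)
Definition proper_fun (R : realType) (T : Type) (h : T -> \bar R) : Prop :=
  (forall w, h w != -oo%E) /\ exists w, h w \is a fin_num.

Definition edom (R : realType) (T : Type) (h : T -> \bar R) : set T :=
  [set w | h w \is a fin_num].

(* h y >= h x + <v, y - x> + o(|y - x|): the error term is eventually bounded
   below by - e |y - x|, for every e > 0. *)
Definition regular_subgradient (R : realType) (n : nat)
    (h : 'rV[R]_n -> \bar R) (x v : 'rV[R]_n) : Prop :=
  edom h x /\
  forall e : R, 0 < e -> \forall y \near x,
    (h x + (dotv v (y - x) - e * enorm (y - x))%:E <= h y)%E.

Definition subdiff (R : realType) (n : nat)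
    (h : 'rV[R]_n -> \bar R) (x : 'rV[R]_n) : set 'rV[R]_n :=
  [set v | edom h x /\
    exists (x_ v_ : nat -> 'rV[R]_n),
      [/\ x_ @ \oo --> x,
          (h \o x_) @ \oo --> h x,
          forall k, regular_subgradient h (x_ k) (v_ k) &
          v_ @ \oo --> v]].

Definition proximal_subgradient (R : realType) (n : nat)
    (h : 'rV[R]_n -> \bar R) (x v : 'rV[R]_n) : Prop :=
  edom h x /\
  exists2 rho : R, 0 < rho & \forall y \near x,
    (h x + (dotv v (y - x) - rho / 2 * enorm (y - x) ^+ 2)%:E <= h y)%E.

Definition locally_lsc (R : realType) (n m : nat)
    (h : 'rV[R]_n * 'rV[R]_m -> \bar R) (wb : 'rV[R]_n * 'rV[R]_m) : Prop :=
  edom h wb /\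
  exists2 eps : R, 0 < eps &
    forall alpha : R, (alpha%:E <= h wb + eps%:E)%E ->
      closed [set w | enorm2 (w - wb) <= eps /\ (h w <= alpha%:E)%E].

(* f(., l) *)
Definition slice (R : realType) (n m : nat)
    (f : 'rV[R]_n * 'rV[R]_m -> \bar R) (l : 'rV[R]_m) : 'rV[R]_n -> \bar R :=
  fun x => f (x, l).

(* "(x, l) and v in the partial subdifferential of f in x at (x, l) are within
   eps of the reference data, f-attentively". If f (x, l) = +oo the extended
   distance of the function values is +oo, so the condition fails. *)
Definition attentive (R : realType) (n m : nat)
    (f : 'rV[R]_n * 'rV[R]_m -> \bar R) (xb vb : 'rV[R]_n) (lb : 'rV[R]_m)
    (eps : R) (x v : 'rV[R]_n) (l : 'rV[R]_m) : Prop :=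
  [/\ enorm (x - xb) < eps,
      (`|f (x, l) - f (xb, lb)| < eps%:E)%E,
      subdiff (slice f l) x v,
      enorm (v - vb) < eps &
      enorm (l - lb) < eps].

Definition para_prox_regular (R : realType) (n m : nat)
    (f : 'rV[R]_n * 'rV[R]_m -> \bar R) (xb vb : 'rV[R]_n) (lb : 'rV[R]_m)
    (eps r : R) : Prop :=
  [/\ 0 < eps /\ 0 <= r,
      proper_fun f,
      locally_lsc f (xb, lb),
      subdiff (slice f lb) xb vb &
      forall (x x' v : 'rV[R]_n) (l : 'rV[R]_m),
        enorm (x' - xb) < eps -> attentive f xb vb lb eps x v l ->
        (f (x, l) + (dotv v (x' - x) - r / 2 * enorm (x' - x) ^+ 2)%:E
           <= f (x', l))%E].

Definition para_hypomonotone (R : realType) (n m : nat)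
    (f : 'rV[R]_n * 'rV[R]_m -> \bar R) (xb vb : 'rV[R]_n) (lb : 'rV[R]_m)
    (eps r : R) : Prop :=
  forall (x0 x1 v0 v1 : 'rV[R]_n) (l : 'rV[R]_m),
    attentive f xb vb lb eps x0 v0 l -> attentive f xb vb lb eps x1 v1 l ->
    - r * enorm (x1 - x0) ^+ 2 <= dotv (v1 - v0) (x1 - x0).

(* Main.v *)
Require Import Defs.
From HB Require Import structures.
From mathcomp Require Import all_boot all_order all_algebra.
From mathcomp Require Import all_classical all_reals all_analysis.
From mathcomp Require Import ring lra.

(* From left to right, add the two para-prox inequalities for the pairs
   [(x0, v0)] and [(x1, v1)].

   From right to left, let [s] exceed both [r] and the modulus [rho] of the
   proximal subgradient, and minimize [f (., l) + s / 2 |. - w|^2] over a small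
   ball around [xb]. A compactness argument, based on joint lower
   semicontinuity and on [s > rho], shows that for [w] near [xb + vb / s] every
   minimizer [p] is close to [xb], so that [p] and [s (w - p)] are subject to the
   hypomonotonicity hypothesis. The Moreau envelope [e w] of [f (., l)] is
   then semiconcave, with gradient [s (w - p)] that is hypomonotone of constant
   [k = r s / (s - r)], hence [e] has quadratic minorants of modulus [k]. Since
   [f (x', l) >= e w - s / 2 |x' - w|^2] for all [w], a suitable choice of [w]
   gives back the modulus [r]. *)

Set Implicit Arguments.
Unset Strict Implicit.
Unset Printing Implicit Defensive.

Import Order.TTheory GRing.Theory Num.Theory.
Import numFieldNormedType.Exports.

Local Open Scope classical_set_scope.
Local Open Scope ring_scope.

(** * Inner product and Euclidean norm *)

Section EuclideanGeometry.
Context {R : realType}.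

Section Algebra.
Context {n : nat}.
Implicit Types (u v w : 'rV[R]_n) (a : R).

Lemma dotvC u v : dotv u v = dotv v u.
Proof. by apply: eq_bigr => i _; rewrite mulrC. Qed.

Lemma dotvDl u v w : dotv (u + v) w = dotv u w + dotv v w.
Proof. by rewrite /dotv -big_split; apply: eq_bigr => i _; rewrite mxE mulrDl. Qed.

Lemma dotvZl a u v : dotv (a *: u) v = a * dotv u v.
Proof. by rewrite /dotv mulr_sumr; apply: eq_bigr => i _; rewrite mxE mulrA. Qed.

Lemma dotvNl u v : dotv (- u) v = - dotv u v.
Proof. by rewrite -scaleN1r dotvZl mulN1r. Qed.

Lemma dotvDr u v w : dotv w (u + v) = dotv w u + dotv w v.
Proof. by rewrite dotvC dotvDl !(dotvC w). Qed.

Lemma dotvZr a u v : dotv v (a *: u) = a * dotv v u.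
Proof. by rewrite dotvC dotvZl dotvC. Qed.

Lemma dotvNr u v : dotv v (- u) = - dotv v u.
Proof. by rewrite dotvC dotvNl dotvC. Qed.

Lemma dotv_ge0 u : 0 <= dotv u u.
Proof. by apply: sumr_ge0 => i _; rewrite -expr2 sqr_ge0. Qed.

Lemma sqr_enorm u : enorm u ^+ 2 = dotv u u.
Proof. by rewrite sqr_sqrtr ?dotv_ge0. Qed.

Lemma enorm_ge0 u : 0 <= enorm u.
Proof. exact: sqrtr_ge0. Qed.

Lemma enorm0 : enorm (0 : 'rV[R]_n) = 0.
Proof. by rewrite /enorm /dotv big1 ?sqrtr0// => i _; rewrite mxE mul0r. Qed.

Lemma coord_le_enorm u i : `|u 0 i| <= enorm u.
Proof.
rewrite -sqrtr_sqr ler_wsqrtr// expr2 /dotv (bigD1 i)//= lerDl.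
by apply: sumr_ge0 => j _; rewrite -expr2 sqr_ge0.
Qed.

Lemma norm_le_enorm u : `|u| <= enorm u.
Proof.
rewrite [leLHS]/Num.Def.normr/= mx_normrE; apply: bigmax_le => [|[i j] _] /=.
  exact: enorm_ge0.
by rewrite (ord1 i) coord_le_enorm.
Qed.

Lemma dotv_eq0 u : dotv u u <= 0 -> u = 0.
Proof.
move=> u0; have : `|u| <= 0.
  rewrite (le_trans (norm_le_enorm u))// /enorm.
  by have -> : dotv u u = 0; [apply/le_anti; rewrite u0 dotv_ge0|rewrite sqrtr0].
by rewrite normr_le0 => /eqP.
Qed.

End Algebra.

Definition dotvE := (@dotvDl, @dotvDr, @dotvZl, @dotvZr, @dotvNl, @dotvNr).

Section Continuity.
Context {T : topologicalType}.

Lemma continuous_subv n (f g : T -> 'rV[R]_n) :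
  continuous f -> continuous g -> continuous (fun t => f t - g t).
Proof. by move=> cf cg t; apply: cvgB; [exact: cf|exact: cg]. Qed.

Lemma continuous_scalev n (a : R) (f : T -> 'rV[R]_n) :
  continuous f -> continuous (fun t => a *: f t).
Proof. by move=> cf t; apply: cvgZr; exact: cf. Qed.

Lemma continuous_subr (f g : T -> R) :
  continuous f -> continuous g -> continuous (fun t => f t - g t).
Proof. by move=> cf cg t; apply: cvgB; [exact: cf|exact: cg]. Qed.

Lemma continuous_dotv n (f g : T -> 'rV[R]_n) :
  continuous f -> continuous g -> continuous (fun t => dotv (f t) (g t)).
Proof.
move=> cf cg; apply: continuous_big => [x|i _ t].
  by apply: cvgD; [exact: cvg_fst|exact: cvg_snd].
apply: continuousM.
  exact: (continuous_comp (cf t) (@coord_continuous R 1 n 0 i (f t))).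
exact: (continuous_comp (cg t) (@coord_continuous R 1 n 0 i (g t))).
Qed.

Lemma continuous_sqr_enorm n (a : R) (f : T -> 'rV[R]_n) :
  continuous f -> continuous (fun t => a * enorm (f t) ^+ 2).
Proof.
move=> cf.
have -> : (fun t => a * enorm (f t) ^+ 2) = (fun t => a * dotv (f t) (f t)).
  by apply/funext => t; rewrite sqr_enorm.
by move=> t; apply: cvgMr; exact: (continuous_dotv cf cf).
Qed.

Lemma continuous_enorm n (f : T -> 'rV[R]_n) :
  continuous f -> continuous (fun t => enorm (f t)).
Proof.
move=> cf t.
exact: (@continuous_comp T R R (fun t => dotv (f t) (f t)) Num.sqrt t
  (@continuous_dotv n f f cf cf t) (@sqrt_continuous R _)).
Qed.

End Continuity.
End EuclideanGeometry.

(** * Lower semicontinuous extended-real functions *)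

Section LowerSemicontinuity.
Context {R : realType} {T : topologicalType}.
Implicit Types (f : T -> \bar R) (q : T -> R).

Lemma continuous_pair (U V : topologicalType) (g : T -> U) (k : T -> V) :
  continuous g -> continuous k -> continuous (fun t => (g t, k t)).
Proof. by move=> cg ck t; apply: cvg_pair; [exact: cg|exact: ck]. Qed.

Lemma lsc_comp (S : topologicalType) f (g : S -> T) :
  lower_semicontinuous f -> continuous g -> lower_semicontinuous (f \o g).
Proof.
move=> lf cg x a /= /lf[V Vx Va]; exists (g @^-1` V); last by move=> y /Va.
exact: cg.
Qed.

Lemma lsc_addr f q : lower_semicontinuous f -> continuous q ->
  lower_semicontinuous (fun x => f x + (q x)%:E)%E.
Proof.
move=> lf cq x a afx.
(* The threshold [a] is split as [b + (a - b)], with strict room left in both summands. *)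
have [b abq bf] : exists2 b, a - b < q x & (b%:E < f x)%E.
  case: (f x) afx => [c| |]//=.
  - rewrite -EFinD lte_fin => ac; exists ((c + (a - q x)) / 2); first lra.
    by rewrite lte_fin; lra.
  - by move=> _; exists (a - q x + 1); [lra|rewrite ltry].
have [V Vx Vb] := lf _ _ bf.
exists (V `&` [set y | a - b < q y]).
  by apply: filterI => //; exact: (cvgr_gt _ (cq x)) abq.
move=> y [/Vb + /=]; case: (f y) => [c| |]//=; rewrite ?ltry// -EFinD !lte_fin.
lra.
Qed.

Lemma lsc_near f x (a : R) : lower_semicontinuous f -> (a%:E < f x)%E ->
  \forall y \near x, (a%:E < f y)%E.
Proof. by move=> lf /lf[V Vx Va]; apply: filterS Vx. Qed.

(** Otherwise each point of [K] is strictly beaten by another one, and by lower semicontinuity so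
    are its neighbours. The near-covering form of compactness, along the filter of sublevel sets in
    [K], then gives a point of [K] that beats all of [K], itself included. *)
Lemma lsc_attains_min f (K : set T) : compact K -> K !=set0 ->
  (forall x, f x != -oo%E) -> lower_semicontinuous f ->
  exists2 x, K x & forall y, K y -> (f x <= f y)%E.
Proof.
move=> /compact_near_coveringP cK [k0 Kk0] fNoo lf; apply: contrapT => nomin.
have better x : K x -> exists2 y, K y & (f y < f x)%E.
  move=> Kx; apply: contrapT => nobetter; apply: nomin; exists x => // y Ky.
  by rewrite leNgt; apply/negP => fyx; apply: nobetter; exists y.
pose F := filter_from K (fun y => [set z | K z /\ (f z <= f y)%E]).
have FF : ProperFilter F.
  apply: filter_from_proper; last by move=> y Ky; exists y.
  apply: filter_from_filter; first by exists k0.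
  move=> y y' Ky Ky'; have [le|/ltW le] := leP (f y) (f y').
    by exists y => // z [Kz zy]; split; split=> //; exact: le_trans le.
  by exists y' => // z [Kz zy]; split; split=> //; exact: le_trans le.
have : \forall i \near F, K `<=` (fun x => (f i < f x)%E).
  apply: cK => x Kx; have [y Ky yx] := better x Kx.
  have yfin : f y \is a fin_num.
    by rewrite fin_numE fNoo/= lt_eqF// (lt_le_trans yx)// leey.
  have /lf[V Vx Va] : ((fine (f y))%:E < f x)%E by rewrite fineK.
  exists (V, [set z | K z /\ (f z <= f y)%E]); first by split => //=; exists y.
  move=> [x' i] /= [/Va + [_ iy]]; rewrite fineK//; exact: le_lt_trans.
have FK : F K by exists k0 => // z [].
move=> /(filterI FK)/filter_ex[i [Ki /(_ _ Ki)]].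
by rewrite ltxx.
Qed.

End LowerSemicontinuity.

(** * Proximal, regular and limiting subgradients *)

Section Subgradients.
Context {R : realType} {n : nat}.
Implicit Types (h : 'rV[R]_n -> \bar R) (x v w p : 'rV[R]_n).

Lemma near_enorm_lt x (e : R) : 0 < e -> \forall y \near x, enorm (y - x) < e.
Proof.
move=> e0; have ct : continuous (fun y : 'rV[R]_n => enorm (y - x)).
  apply: continuous_enorm; apply: continuous_subv; last exact: cst_continuous.
  by move=> y; exact: cvg_id.
by apply: (cvgr_lt _ (ct x)); rewrite subrr enorm0.
Qed.

Lemma proximal_subgradient_regular h x v :
  proximal_subgradient h x v -> regular_subgradient h x v.
Proof.
move=> [xdom [rho rho0 prox]]; split=> // e e0; near=> y.
(* Within this radius the quadratic error is at most [e * enorm (y - x)]. *)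
have yx : enorm (y - x) <= e / (rho / 2).
  by apply/ltW; near: y; apply: near_enorm_lt; rewrite !divr_gt0.
apply: (@le_trans _ _ (h x + (dotv v (y - x) - rho / 2 * enorm (y - x) ^+ 2)%:E)%E).
  rewrite leeD2l// lee_fin lerB// expr2 mulrA ler_wpM2r ?enorm_ge0//.
  by rewrite mulrC -ler_pdivlMr// divr_gt0.
by near: y.
Unshelve. all: by end_near. Qed.

Lemma proximal_subgradient_subdiff h x v :
  proximal_subgradient h x v -> subdiff h x v.
Proof.
move=> hv; split; first by case: hv.
exists (fun=> x), (fun=> v); split; [exact: cvg_cst|exact: cvg_cst| |exact: cvg_cst].
by move=> _; exact: proximal_subgradient_regular.
Qed.

(** A proximal point of [h] at [w] with parameter [1 / s], under the constraint [K]; a relation,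
    because minimizers need not be unique. *)
Definition prox_min h (K : set 'rV[R]_n) (s : R) w p :=
  K p /\ forall y, K y ->
    (h p + (s / 2 * enorm (p - w) ^+ 2)%:E <=
     h y + (s / 2 * enorm (y - w) ^+ 2)%:E)%E.

(** The constraint is inactive near [p]; expanding the squares around [p] turns minimality into the
    proximal inequality of modulus [s]. *)
Lemma prox_min_subgradient h (K : set 'rV[R]_n) (s : R) w p :
  0 < s -> edom h p -> nbhs p K -> prox_min h K s w p ->
  proximal_subgradient h p (s *: (w - p)).
Proof.
move=> s0 pdom pK [_ pmin]; split=> //; exists s => //; near=> y.
have : K y by near: y.
move=> /pmin; rewrite -(fineK pdom); case: (h y) => [c| |]//;
  last by move=> _; rewrite leey.
rewrite -!EFinD !lee_fin !sqr_enorm !dotvE.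
rewrite (dotvC p w) (dotvC p y) (dotvC y w); lra.
Unshelve. all: by end_near. Qed.

End Subgradients.

Lemma lsc_locally_lsc (R : realType) (n m : nat)
    (f : 'rV[R]_n * 'rV[R]_m -> \bar R) wb :
  lower_semicontinuous f -> edom f wb -> locally_lsc f wb.
Proof.
move=> /lower_semicontinuousP lf wbdom; split=> //; exists 1 => // a _.
have -> : [set w | enorm2 (w - wb) <= 1 /\ (f w <= a%:E)%E] =
    (fun w => enorm2 (w - wb)) @^-1` [set t | t <= 1] `&`
    ~` [set w | (a%:E < f w)%E].
  by apply/seteqP; split=> w /= [? fw]; split=> //;
    [apply/negP; rewrite -leNgt|rewrite leNgt; apply/negP].
apply: closedI; last exact: open_closedC.
apply: closed_comp; last exact: closed_le.
move=> w _; have c1 : continuous (fun w : 'rV[R]_n * 'rV[R]_m => (w - wb).1).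
  by move=> {}w; apply: cvgB; [exact: cvg_fst|exact: cvg_cst].
have c2 : continuous (fun w : 'rV[R]_n * 'rV[R]_m => (w - wb).2).
  by move=> {}w; apply: cvgB; [exact: cvg_snd|exact: cvg_cst].
have cD : continuous (fun w : 'rV[R]_n * 'rV[R]_m =>
    dotv (w - wb).1 (w - wb).1 + dotv (w - wb).2 (w - wb).2).
  by move=> {}w; apply: cvgD; [exact: (continuous_dotv c1 c1)|
    exact: (continuous_dotv c2 c2)].
exact: (@continuous_comp _ R R _ Num.sqrt w (cD w) (@sqrt_continuous R _)).
Qed.

(** * From para-prox-regularity to hypomonotonicity *)

Section ParaProx.
Context {R : realType} {n m : nat}.
Variable f : 'rV[R]_n * 'rV[R]_m -> \bar R.
Implicit Types (x v w p : 'rV[R]_n) (l : 'rV[R]_m) (eps r s : R).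

Lemma para_prox_regular_attentive xb vb lb eps r :
  para_prox_regular f xb vb lb eps r -> attentive f xb vb lb eps xb vb lb.
Proof.
move=> [[eps0 _] _ [xbdom _] xbvb _]; split=> //; rewrite ?subrr ?enorm0//.
by rewrite subee// abse0 lte_fin.
Qed.

(** The reference data satisfy their own closeness conditions, so the uniform inequality applies to
    them, and [r] serves as the modulus [rho]. *)
Lemma para_prox_regular_proximal xb vb lb eps r : 0 < r ->
  para_prox_regular f xb vb lb eps r -> proximal_subgradient (slice f lb) xb vb.
Proof.
move=> r0 fr; have att := para_prox_regular_attentive fr.
case: fr => -[eps0 _] _ [xbdom _] _ ineq.
split=> //; exists r => //; near=> y; apply: ineq => //.
by near: y; exact: near_enorm_lt.
Unshelve. all: by end_near. Qed.

Lemma para_prox_regular_hypomonotone xb vb lb eps r :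
  para_prox_regular f xb vb lb eps r -> para_hypomonotone f xb vb lb eps r.
Proof.
move=> [_ _ _ _ ineq] x0 x1 v0 v1 l att0 att1.
have := ineq x0 x1 v0 l _ att0; have := ineq x1 x0 v1 l _ att1.
case: att0 att1 => near0 _ [fin0 _] _ _ [near1 _ [fin1 _] _ _].
move: fin0 fin1; rewrite /edom/= /slice => fin0 fin1.
move=> /(_ near0) le1 /(_ near1); move: le1.
rewrite -(fineK fin0) -(fineK fin1) -!EFinD !lee_fin !sqr_enorm !dotvE.
rewrite (dotvC x1 x0); lra.
Qed.

End ParaProx.

(** * Quadratic minorants from hypomonotone gradients *)

(* The minorant at [w] is applied at the midpoint [c] of [w] and [w'], and the one
   at [c] is applied at [w']. *)
Lemma hypomonotone_midpoint (R : realType) (n : nat) (W : set 'rV[R]_n)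
    (e : 'rV[R]_n -> R) (V : 'rV[R]_n -> 'rV[R]_n) (k : R) :
  (forall w w', W w -> W w' -> W (2^-1 *: (w + w'))) ->
  (forall w w', W w -> W w' ->
    - k * dotv (w' - w) (w' - w) <= dotv (V w' - V w) (w' - w)) ->
  forall S, (forall w w', W w -> W w' ->
    e w + dotv (V w) (w' - w) - S / 2 * dotv (w' - w) (w' - w) <= e w') ->
  forall w w', W w -> W w' ->
    e w + dotv (V w) (w' - w) - ((S + k) / 2) / 2 * dotv (w' - w) (w' - w) <= e w'.
Proof.
move=> Wmid hypo S bnd w w' Ww Ww'.
have Wm := Wmid _ _ Ww Ww'; set c := 2^-1 *: _ in Wm.
have cw : c - w = 2^-1 *: (w' - w).
  by apply/rowP => i; rewrite !mxE; lra.
have w'c : w' - c = 2^-1 *: (w' - w).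
  by apply/rowP => i; rewrite !mxE; lra.
have := hypo _ _ Ww Wm; have := bnd _ _ Ww Wm; have := bnd _ _ Wm Ww'.
rewrite w'c cw (dotvDl (V c)) dotvNl !dotvZr !dotvZl; nra.
Qed.

(** Semiconcavity and hypomonotonicity together give the crude modulus [s + 2 * k]. Each use of the
    midpoint lemma halves its excess over [k], and the limit is [k]. This stands in for integrating
    the gradient along the segment. *)
Lemma semiconcave_hypomonotone (R : realType) (n : nat) (W : set 'rV[R]_n)
    (e : 'rV[R]_n -> R) (V : 'rV[R]_n -> 'rV[R]_n) (k s : R) :
  (forall w w', W w -> W w' -> W (2^-1 *: (w + w'))) ->
  (forall w w', W w -> W w' ->
    - k * dotv (w' - w) (w' - w) <= dotv (V w' - V w) (w' - w)) ->
  (forall w w', W w -> W w' ->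
    e w + dotv (V w') (w' - w) - s / 2 * dotv (w' - w) (w' - w) <= e w') ->
  forall w w', W w -> W w' ->
    e w + dotv (V w) (w' - w) - k / 2 * dotv (w' - w) (w' - w) <= e w'.
Proof.
move=> Wmid hypo conc w w' Ww Ww'.
have bnd j : forall w w', W w -> W w' -> e w + dotv (V w) (w' - w)
    - (k + (s + k) / 2 ^+ j) / 2 * dotv (w' - w) (w' - w) <= e w'.
  elim: j => [|j IH] {Ww Ww'} {}w {}w' Ww Ww'.
    rewrite expr0 divr1; have := hypo _ _ Ww Ww'; have := conc _ _ Ww Ww'.
    by rewrite (dotvDl (V w')) dotvNl; nra.
  have := hypomonotone_midpoint Wmid hypo IH Ww Ww'.
  suff -> : (k + (s + k) / 2 ^+ j + k) / 2 = k + (s + k) / 2 ^+ j.+1 by [].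
  by rewrite exprS; field; rewrite expf_neq0.
set d := dotv (w' - w) (w' - w).
rewrite leNgt; apply/negP => lt_e.
(* A failure by [g] would survive all the halvings: [g * 2 ^+ j <= X] for every [j], against the
   Archimedean property. *)
set g := e w + dotv (V w) (w' - w) - k / 2 * d - e w'.
have g0 : 0 < g by rewrite subr_gt0.
pose X := (s + k) / 2 * d.
have gX j : g * 2 ^+ j <= X.
  rewrite -ler_pdivlMr ?exprn_gt0//; have := bnd j _ _ Ww Ww'.
  by rewrite -/d /g /X; lra.
have X0 : 0 <= X by rewrite (le_trans _ (gX 0)) ?expr0 ?mulr1 ?ltW.
have := archi_boundP (divr_ge0 X0 (ltW g0)).
set j := Num.bound _; apply/negP; rewrite -leNgt ler_pdivlMr// mulrC.
rewrite (le_trans _ (gX j))// ler_pM2l// -natrX ler_nat.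
exact/ltnW/ltn_expl.
Qed.

(** * Proximal map and Moreau envelope *)

Section ProximalMap.
Context {R : realType} {n : nat}.
Implicit Types (x v w p d : 'rV[R]_n).

(** For the increments [d] of [w] and [q] of [p], the hypothesis reads [(s - r) |q|^2 <= s <d, q>].
    Expanding the square of [s d - (s - r) q] then gives [(s - r) <d, q> <= s |d|^2], and the claim
    is a rearrangement of this. *)
Lemma prox_residual_hypomonotone (r s : R) w w' p p' : 0 < r < s ->
  - r * dotv (p' - p) (p' - p) <=
    dotv (s *: (w' - p') - s *: (w - p)) (p' - p) ->
  - (r * s / (s - r)) * dotv (w' - w) (w' - w) <=
    dotv (s *: (w' - p') - s *: (w - p)) (w' - w).
Proof.
move=> /andP[r0 rs].
have -> : s *: (w' - p') - s *: (w - p) = s *: ((w' - w) - (p' - p)).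
  by apply/rowP => i; rewrite !mxE; lra.
move: (w' - w) (p' - p) => d q hypo.
have := dotv_ge0 (s *: d - (s - r) *: q); move: hypo.
rewrite !dotvE (dotvC q d).
set D := dotv d d; set Q := dotv q q; set B := dotv d q => hypo sq.
have QB : (s - r) * ((s - r) * Q) <= (s - r) * (s * B) by rewrite ler_pM2l; lra.
have DB : 0 <= s * D - (s - r) * B by rewrite -(pmulr_rge0 _ (_ : 0 < s)); lra.
have -> : s * (D - B) =
    s / (s - r) * (s * D - (s - r) * B) - r * s / (s - r) * D by field; lra.
have : 0 <= s / (s - r) * (s * D - (s - r) * B).
  by rewrite mulr_ge0// divr_ge0; lra.
lra.
Qed.

(* The fraction [1 - r / s] of the segment is the one that optimizes the
   modulus obtained for [h] from that of its Moreau envelope. *)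
Lemma hypomonotone_prox_regular (h : 'rV[R]_n -> \bar R)
    (K W : set 'rV[R]_n) (G : 'rV[R]_n -> 'rV[R]_n -> Prop) (r s : R) :
  0 < r < s ->
  (forall w w', W w -> W w' -> W (2^-1 *: (w + w'))) ->
  (forall p v, G p v -> edom h p) ->
  (forall p p' v v', G p v -> G p' v' ->
    - r * enorm (p' - p) ^+ 2 <= dotv (v' - v) (p' - p)) ->
  (forall w, W w -> exists2 p, prox_min h K s w p & G p (s *: (w - p))) ->
  forall x x' v, G x v -> K x' -> h x' != -oo%E ->
    W (x + s^-1 *: v) -> W (x + s^-1 *: v + (1 - r / s) *: (x' - x)) ->
    (h x + (dotv v (x' - x) - r / 2 * enorm (x' - x) ^+ 2)%:E <= h x')%E.
Proof.
move=> rs Wmid Gdom hypo prox x x' v Gxv Kx' hx'; have /andP[r0 ltrs] := rs.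
have s0 : 0 < s by lra.
set z := x + s^-1 *: v; set w1 := z + _ => Wz Ww1.
(* Uniqueness is not known at this stage, so a minimizer is chosen for each [w] in [W]; outside [W]
   the value is arbitrary. *)
have /choice[p pP] : forall w, exists q,
    W w -> prox_min h K s w q /\ G q (s *: (w - q)).
  move=> w; have [/prox[q ? ?]|nWw] := pselect (W w); first by exists q.
  by exists w.
have pdom w : W w -> h (p w) = (fine (h (p w)))%:E.
  by move=> /pP[_ /Gdom ?]; rewrite fineK.
pose V w := s *: (w - p w).
pose e w := fine (h (p w)) + s / 2 * dotv (p w - w) (p w - w).
pose k := r * s / (s - r).
have Vhypo w w' : W w -> W w' ->
    - k * dotv (w' - w) (w' - w) <= dotv (V w' - V w) (w' - w).
  move=> /pP[_ Gw] /pP[_ Gw']; apply: prox_residual_hypomonotone => //.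
  by rewrite -sqr_enorm; exact: hypo.
(* [p w'] is a competitor in the problem at [w]: the envelope is a minimum of quadratics in [w] of
   the same curvature [s], hence semiconcave. *)
have econc w w' : W w -> W w' ->
    e w + dotv (V w') (w' - w) - s / 2 * dotv (w' - w) (w' - w) <= e w'.
  move=> Ww Ww'; have [[Kpw' _] _] := pP _ Ww'.
  have [[_ /(_ _ Kpw') le] _] := pP _ Ww.
  move: le; rewrite (pdom _ Ww) (pdom _ Ww') -!EFinD lee_fin !sqr_enorm /e /V.
  rewrite !dotvE (dotvC w' w) !(dotvC (p _)); lra.
(* Hypomonotonicity between [(x, v)] and the pair at [p z] gives [(s - r) |p z - x|^2 <= 0]. *)
have pz : p z = x.
  apply/eqP; rewrite -subr_eq0; apply/eqP/dotv_eq0.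
  have [_ Gz] := pP _ Wz; have := hypo _ _ _ _ Gxv Gz.
  have -> : s *: (z - p z) - v = - (s *: (p z - x)).
    by apply/rowP => i; rewrite !mxE; field; lra.
  rewrite sqr_enorm dotvNl dotvZl => le.
  by rewrite -(pmulr_rle0 _ (_ : 0 < s - r)); lra.
have Vz : V z = v by rewrite /V pz; apply/rowP => i; rewrite !mxE; field; lra.
(* The envelope at [w1] is bounded below by its minorant at [z], and above by testing its
   minimization with [x']. *)
have := semiconcave_hypomonotone Wmid Vhypo econc Wz Ww1.
have [[_ /(_ _ Kx') le] _] := pP _ Ww1; move: le.
have hx : h x = (fine (h x))%:E by rewrite fineK//; exact: Gdom Gxv.
rewrite (pdom _ Ww1) hx; case: (h x') hx' => [c| |]//;
  last by move=> *; rewrite leey.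
move=> _; rewrite -!EFinD !lee_fin !sqr_enorm /e Vz pz.
have -> : w1 - z = (1 - r / s) *: (x' - x) by rewrite /w1 addrC addKr.
have -> : x' - w1 = s^-1 *: (r *: (x' - x) - v).
  by apply/rowP => i; rewrite !mxE; field; lra.
have -> : x - z = - (s^-1 *: v) by rewrite /z opprD addNKr.
move: (x' - x) (fine (h (p w1)) + _) => d E; rewrite !dotvE (dotvC d v).
set A := dotv v v; set B := dotv v d; set D := dotv d d.
move=> le1 le2.
have : fine (h x) + s / 2 * - - (s^-1 * (s^-1 * A)) + (1 - r / s) * B
    - k / 2 * ((1 - r / s) * ((1 - r / s) * D))
    - s / 2 * (s^-1 * (s^-1 * (r * (r * D) - r * B - r * B + A))) <= c by lra.
(* Nothing is lost here: by the choice of [w1], the moduli [k] and [s] recombine exactly into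
   [r]. *)
apply: le_trans; rewrite le_eqVlt; apply/orP; left; apply/eqP.
by rewrite /k; field; lra.
Qed.

End ProximalMap.

(** * Stability of proximal points under perturbation *)

Section Localization.
Context {R : realType} {n m : nat}.
Variable f : 'rV[R]_n * 'rV[R]_m -> \bar R.
Implicit Types (x v w p : 'rV[R]_n) (l : 'rV[R]_m).

(* In the indices [(l, w, x, a)] below, [a] stands for the value [f (x, l)] at a
   feasible point [x]: [f (_, l)] may be identically [+oo] near [xb]. *)
Lemma prox_min_localization (K : set 'rV[R]_n) (xb vb : 'rV[R]_n) lb (s : R) :
  proper_fun f -> lower_semicontinuous f -> edom f (xb, lb) -> 0 < s ->
  compact K -> nbhs xb K ->
  (forall y, K y -> y != xb ->
    (f (xb, lb) + (s / 2 * enorm (s^-1 *: vb) ^+ 2)%:E <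
     f (y, lb) + (s / 2 * enorm (y - (xb + s^-1 *: vb)) ^+ 2)%:E)%E) ->
  forall eps : R, 0 < eps -> exists2 eta : R, 0 < eta &
    forall l w x, `|l - lb| < eta -> `|w - (xb + s^-1 *: vb)| < eta ->
      `|x - xb| < eta -> (`|f (x, l) - f (xb, lb)| < eta%:E)%E ->
      exists2 p, prox_min (slice f l) K s w p &
        attentive f xb vb lb eps p (s *: (w - p)) l.
Proof.
move=> [fNoo _] lf fdom s0 cK xbK strict eps eps0.
set z := xb + s^-1 *: vb; pose c := fine (f (xb, lb)).
have fc : f (xb, lb) = c%:E by rewrite fineK.
pose I : topologicalType := ('rV[R]_m * 'rV[R]_n * 'rV[R]_n * R)%type.
pose T : topologicalType := ('rV[R]_n * I)%type.
pose i0 : I := (lb, z, xb, c).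
pose yw (u : T) : 'rV[R]_n := u.1 - u.2.1.1.2.
pose wy (u : T) : 'rV[R]_n := u.2.1.1.2 - u.1.
pose xw (u : T) : 'rV[R]_n := u.2.1.2 - u.2.1.1.2.
(* [F u + q u] is the penalized value at the candidate [u.1] minus that at the competitor [x]; its
   positivity, [bad], bars the candidate from being a minimizer. *)
pose q (u : T) : R := s / 2 * enorm (yw u) ^+ 2 - u.2.2 - s / 2 * enorm (xw u) ^+ 2.
pose F (u : T) := f (u.1, u.2.1.1.1).
(* A minimizer has [F u + q u <= 0], so the lower bound on [q] yields the upper bound on [f] that
   lower semicontinuity cannot give. *)
pose good (u : T) := [/\ enorm (u.1 - xb) < eps, nbhs u.1 K,
  ((c - eps)%:E < F u)%E, - (c + eps) < q u & enorm (s *: wy u - vb) < eps].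
pose bad (u : T) := (0 < F u + (q u)%:E)%E.
have cfst (A B : topologicalType) : continuous (@fst A B).
  by move=> u; exact: cvg_fst.
have csnd (A B : topologicalType) : continuous (@snd A B).
  by move=> u; exact: cvg_snd.
have c1 : continuous (fun u : T => u.1) by move=> u; exact: cvg_fst.
have c2 : continuous (fun u : T => u.2) by move=> u; exact: cvg_snd.
have c3 : continuous (fun i : I => i.1) by move=> u; exact: cvg_fst.
have c4 : continuous (fun i : I => i.1.1).
  by move=> i; exact: (continuous_comp (c3 i) (@cfst _ _ _)).
have c5 : continuous (fun i : I => i.1.1.1).
  by move=> i; exact: (continuous_comp (c4 i) (@cfst _ _ _)).
have c6 : continuous (fun i : I => i.1.1.2).
  by move=> i; exact: (continuous_comp (c4 i) (@csnd _ _ _)).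
have c7 : continuous (fun i : I => i.1.2).
  by move=> i; exact: (continuous_comp (c3 i) (@csnd _ _ _)).
have c8 : continuous (fun i : I => i.2) by move=> i; exact: cvg_snd.
have cyw : continuous yw.
  by apply: continuous_subv c1 _ => u; exact: (continuous_comp (c2 u) (c6 _)).
have cwy : continuous wy.
  by apply: continuous_subv _ c1 => u; exact: (continuous_comp (c2 u) (c6 _)).
have cxw : continuous xw.
  by apply: continuous_subv => u;
    [exact: (continuous_comp (c2 u) (c7 _))|exact: (continuous_comp (c2 u) (c6 _))].
have c9 : continuous (fun u : T => u.2.2).
  by move=> u; exact: (continuous_comp (c2 u) (c8 _)).
have cq : continuous q.
  apply: continuous_subr; last exact: continuous_sqr_enorm.
  exact: (continuous_subr (continuous_sqr_enorm cyw) c9).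
have lF : lower_semicontinuous F.
  apply: (lsc_comp lf); apply: (continuous_pair c1) => u.
  exact: (continuous_comp (c2 u) (c5 _)).
have near_good : \forall u \near (xb, i0), good u.
  have n1 : \forall u \near (xb, i0), enorm (u.1 - xb) < eps.
    exact: (c1 (xb, i0) _ (near_enorm_lt xb eps0)).
  have n2 : \forall u \near (xb, i0), nbhs u.1 K.
    exact: (c1 (xb, i0) _ (nbhs_interior xbK)).
  have n3 : \forall u \near (xb, i0), ((c - eps)%:E < F u)%E.
    by apply: lsc_near lF _; rewrite /F/= fc lte_fin; lra.
  have n4 : \forall u \near (xb, i0), - (c + eps) < q u.
    by apply: (cvgr_gt _ (cq (xb, i0))); rewrite /q /yw /xw/=; lra.
  have cv : continuous (fun u => enorm (s *: wy u - vb)).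
    apply: continuous_enorm; apply: continuous_subv; last exact: cst_continuous.
    exact: (continuous_scalev cwy).
  have n5 : \forall u \near (xb, i0), enorm (s *: wy u - vb) < eps.
    apply: (cvgr_lt _ (cv (xb, i0))).
    have -> : wy (xb, i0) = s^-1 *: vb by rewrite /wy/= /z addrC addKr.
    by rewrite scalerA divff ?gt_eqF// scale1r subrr enorm0.
  by near=> u; split; near: u.
(* By [strict], every other point of [K] is bad at [i0]; lower semicontinuity extends this to nearby
   points and indices. *)
have near_bad y : K y -> y != xb -> \forall u \near (y, i0), bad u.
  move=> Ky yxb; apply: lsc_near (lsc_addr lF cq) _.
  have := strict _ Ky yxb; rewrite fc -EFinD /F /q /yw /xw/= -/z.
  have -> : xb - z = - (s^-1 *: vb) by rewrite /z opprD addNKr.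
  rewrite !sqr_enorm dotvNl dotvNr opprK.
  case: (f (y, lb)) => [b| |]//; last by move=> _; rewrite ltry.
  by rewrite -!EFinD !lte_fin; lra.
(* Compactness makes the dichotomy hold for all candidates at once, for every index near [i0]. *)
have : \forall i \near i0, K `<=` (fun y => good (y, i) \/ bad (y, i)).
  apply: (iffLR (compact_near_coveringP K) cK _ _
    (fun i y => good (y, i) \/ bad (y, i)) (nbhs_filter i0)) => y Ky.
  have : \forall u \near (y, i0), good u \/ bad u.
    have [->|yxb] := eqVneq y xb; first by apply: filterS near_good => u; left.
    by apply: filterS (near_bad _ Ky yxb) => u; right.
  by apply: filterS => -[].
have near_lb : \forall i \near i0, enorm (i.1.1.1 - lb) < eps.
  exact: (c5 i0 _ (near_enorm_lt lb eps0)).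
have near_K : \forall i \near i0, K i.1.2 by exact: (c7 i0).
move=> near_cover.
have [eta /= eta0 ball_eta] := (@nbhs_ballP R
  ('rV[R]_m * 'rV[R]_n * 'rV[R]_n * R)%type i0 _).1
  (filterI near_cover (filterI near_lb near_K)).
exists eta => // l w x llb wz xxb fxl.
have xfin : f (x, l) \is a fin_num.
  rewrite fin_numE fNoo/=; apply/negP => /eqP foo; move: fxl.
  by rewrite foo fc.
pose a := fine (f (x, l)); have fa : f (x, l) = a%:E by rewrite fineK.
pose i := (l, w, x, a).
have [cover enl Kx] : [/\ K `<=` (fun y => good (y, i) \/ bad (y, i)),
    enorm (l - lb) < eps & K x].
  have [] := ball_eta i.
    split; last first.
      by rewrite -ball_normE /ball_/= distrC -lte_fin -abse_EFin EFinB -fa -fc.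
    split; last by rewrite -ball_normE /ball_/= distrC.
    by split; rewrite -ball_normE /ball_/= distrC.
  by move=> ? [].
have [p Kp pmin] : exists2 p, K p & forall y, K y ->
    (slice f l p + (s / 2 * enorm (p - w) ^+ 2)%:E <=
     slice f l y + (s / 2 * enorm (y - w) ^+ 2)%:E)%E.
  apply: lsc_attains_min cK _ _ _.
  - by exists x.
  - by move=> y; rewrite /slice; case: (f (y, l)) (fNoo (y, l)).
  - apply: lsc_addr.
      by apply: (lsc_comp lf); apply: continuous_pair;
        [move=> ?; exact: cvg_id|exact: cst_continuous].
    have cyw' : continuous (fun y : 'rV[R]_n => y - w).
      by apply: continuous_subv; [move=> ?; exact: cvg_id|exact: cst_continuous].
    exact: continuous_sqr_enorm cyw'.
exists p => //.
(* Comparison with [x] rules out the bad alternative for [p]. *)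
have := pmin x Kx; rewrite /slice fa -EFinD.
have : f (p, l) != -oo%E by exact: fNoo.
case fp : (f (p, l)) => [b| |]// _; rewrite -EFinD lee_fin => le_b.
have [[/= pxb pK Fp qp vp]|] := cover p Kp; last first.
  by rewrite /bad/F/q/yw/xw/= fp -EFinD lte_fin; lra.
have pdom : edom (slice f l) p by rewrite /edom/= /slice fp.
split=> //.
  rewrite fp fc -EFinB lte_fin ltr_norml; move: Fp qp.
  by rewrite /F/q/yw/xw/= fp lte_fin; lra.
apply: proximal_subgradient_subdiff; exact: prox_min_subgradient pK _.
Unshelve. all: by end_near. Qed.

End Localization.

(** * From hypomonotonicity to para-prox-regularity *)

Lemma compact_closed_ball (R : realType) (n : nat) (x : 'rV[R]_n) (e : R) :
  0 < e -> compact (closed_ball x e).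
Proof.
move=> e0; apply: bounded_closed_compact; last exact: closed_ball_closed.
exists (`|x| + e); split; first exact: num_real.
move=> M xM y; rewrite closed_ballE// /closed_ball_/= => xy.
by rewrite (le_trans _ (ltW xM))// -[y](subKr x) (le_trans (ler_normB _ _))// lerD2l.
Qed.

Section Converse.
Context {R : realType} {n m : nat}.
Variable f : 'rV[R]_n * 'rV[R]_m -> \bar R.
Implicit Types (x v w p : 'rV[R]_n) (l : 'rV[R]_m).

Lemma hypomonotone_para_prox_regular (xb vb : 'rV[R]_n) lb (eps r : R) :
  proper_fun f -> lower_semicontinuous f -> 0 < r -> 0 < eps ->
  proximal_subgradient (slice f lb) xb vb ->
  para_hypomonotone f xb vb lb eps r ->
  exists2 eps' : R, 0 < eps' <= eps & para_prox_regular f xb vb lb eps' r.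
Proof.
move=> fproper lf r0 eps0 prox hypo.
have [fdom [rho rho0 nearprox]] := prox.
have [e /= proxK] := (nbhs_closedballP _ _).1 nearprox.
set K := closed_ball xb e%:num in proxK.
have ballK (y : 'rV[R]_n) : `|y - xb| < e%:num -> K y.
  move=> ye; apply: subset_closed_ball.
  by rewrite -ball_normE /= distrC.
(* The part [rho] absorbs the proximal error, and the part [r] leaves the strict margin
   [r / 2 * |y - xb|^2]. *)
pose s := rho + r.
have s0 : 0 < s by rewrite addr_gt0.
have xbK : nbhs xb K.
  by apply: filterS (nbhsx_ballx _ _ (gt0 e)); exact: subset_closed_ball.
have strict (y : 'rV[R]_n) : K y -> y != xb ->
    (f (xb, lb) + (s / 2 * enorm (s^-1 *: vb) ^+ 2)%:E <
     f (y, lb) + (s / 2 * enorm (y - (xb + s^-1 *: vb)) ^+ 2)%:E)%E.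
  move=> /proxK; rewrite /slice -subr_eq0 => + yxb.
  have y0 : 0 < dotv (y - xb) (y - xb).
    by rewrite ltNge; apply/negP => /dotv_eq0/eqP; apply/negP.
  rewrite -[f (xb, lb)]fineK//; case: (f (y, lb)) => [a| |]//; last by rewrite ltry.
  rewrite -!EFinD lee_fin lte_fin !sqr_enorm.
  have -> : y - (xb + s^-1 *: vb) = (y - xb) - s^-1 *: vb by rewrite opprD addrA.
  move: (y - xb) y0 => d d0 le; rewrite !dotvE (dotvC d vb).
  set D := dotv d d in d0 le *; set B := dotv vb d in le *; set A := dotv vb vb.
  have : s / 2 * (D - s^-1 * B - (s^-1 * B - s^-1 * (s^-1 * A))) =
      rho / 2 * D + r / 2 * D - B + s / 2 * (s^-1 * (s^-1 * A)).
    by rewrite /s; field; rewrite -/s gt_eqF.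
  have : 0 < r / 2 * D by rewrite mulr_gt0 ?divr_gt0.
  lra.
have [eta eta0 loc] := prox_min_localization fproper lf fdom s0
  (@compact_closed_ball _ _ xb e%:num (gt0 e)) xbK strict eps0.
(* The point [x + s^-1 *: v] will lie within [eps' * (1 + s^-1)] of [xb + s^-1 *: vb], and the
   second test point at most [2 * eps'] further; [4] instead of [3] keeps the total strictly below
   [eta]. *)
pose eps' := Num.min eps (Num.min e%:num (eta / (4 + s^-1))).
have eps'0 : 0 < eps'.
  by rewrite !lt_min eps0 gt0/= divr_gt0// addr_gt0// invr_gt0.
have le_eps : eps' <= eps by rewrite ge_min lexx.
have le_e : eps' <= e%:num by rewrite !ge_min lexx orbT.
have le_eta : eps' * (4 + s^-1) <= eta.
  by rewrite -ler_pdivlMr ?addr_gt0 ?invr_gt0// !ge_min lexx !orbT.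
have eps's : 0 <= eps' * s^-1 by rewrite mulr_ge0 ?invr_ge0 ?ltW.
exists eps'; first by rewrite eps'0.
split=> //; [by split=> //; exact: ltW|exact: lsc_locally_lsc|
  exact: proximal_subgradient_subdiff|].
move=> x x' v l x'xb [xxb fxl xv vvb llb].
(* The hypotheses are Euclidean, whereas [K], [W] and [eta] refer to the max norm, which is no
   larger. *)
have normlt k (a b : 'rV[R]_k) : enorm (a - b) < eps' -> `|a - b| < eps'.
  exact/le_lt_trans/norm_le_enorm.
have xxb' := normlt _ _ _ xxb; have x'xb' := normlt _ _ _ x'xb.
have vvb' := normlt _ _ _ vvb; have llb' := normlt _ _ _ llb.
pose W := [set w | `|w - (xb + s^-1 *: vb)| < eta].
(* The radius is [eps], not [eps']: the minimizers are only localized at that scale, which is the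
   one of [hypo]. *)
pose G p u := attentive f xb vb lb eps p u l.
have zeta : `|x + s^-1 *: v - (xb + s^-1 *: vb)| <= eps' + eps' * s^-1.
  have -> : x + s^-1 *: v - (xb + s^-1 *: vb) = (x - xb) + s^-1 *: (v - vb).
    by apply/rowP => i; rewrite !mxE; lra.
  rewrite (le_trans (ler_normD _ _))// lerD ?(ltW xxb')// normrZ.
  by rewrite gtr0_norm ?invr_gt0// mulrC ler_wpM2r ?invr_ge0 ?ltW.
apply: (@hypomonotone_prox_regular _ _ (slice f l) K W G r s).
- by rewrite r0 /s ltrDr.
- move=> w w'; rewrite /W /= => Ww Ww'; set b := xb + _ in Ww Ww' *.
  have -> : 2^-1 *: (w + w') - b = 2^-1 *: ((w - b) + (w' - b)).
    by apply/rowP => i; rewrite !mxE; lra.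
  rewrite normrZ ger0_norm// ltr_pdivrMl// (le_lt_trans (ler_normD _ _))//.
  lra.
- by move=> p u [_ _ [pdom _]].
- by move=> p p' u u'; exact: hypo.
(* [x] itself is the feasible competitor that the localization requires at the parameter [l]. *)
- move=> w Ww; apply: (loc l w x) => //; first lra; first lra.
  by rewrite (lt_le_trans fxl)// lee_fin; lra.
- split=> //; [exact: lt_le_trans le_eps|by rewrite (lt_le_trans fxl)//|
    exact: lt_le_trans le_eps|exact: lt_le_trans le_eps].
- by apply: ballK; lra.
- by case: fproper => fNoo _; exact: fNoo.
- by rewrite /W/=; lra.
- rewrite /W/= addrAC (le_lt_trans (ler_normD _ _))//.
  have dd : `|x' - x| <= 2 * eps'.
    have -> : x' - x = (x' - xb) - (x - xb) by rewrite opprB addrA subrK.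
    rewrite (le_trans (ler_normB _ _))//; lra.
  have : `|(1 - r / s) *: (x' - x)| <= 2 * eps'.
    rewrite normrZ (le_trans _ dd)// ler_piMl// ger0_norm.
      by rewrite gerBl divr_ge0// ltW.
    by rewrite subr_ge0 ler_pdivrMr// mul1r /s lerDr ltW.
  lra.
Qed.

End Converse.

(* The modulus r is the same on both sides. The radius eps is kept from left to
   right; from right to left it may have to shrink: the right-hand side only
   constrains points where f is within eps of f (xb, lb), whereas
   para-prox-regularity compares with every x' of the eps-ball. *)
Theorem corollary4p4 (R : realType) (n m : nat)
    (f : 'rV[R]_n * 'rV[R]_m -> \bar R)
    (xb vb : 'rV[R]_n) (lb : 'rV[R]_m)
    (f_proper : proper_fun f) (f_lsc : lower_semicontinuous f)
    (f_dom : edom f (xb, lb)) (r : R) (r_gt0 : 0 < r) :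
  (forall eps : R, 0 < eps ->
     para_prox_regular f xb vb lb eps r ->
     proximal_subgradient (slice f lb) xb vb /\
     para_hypomonotone f xb vb lb eps r) /\
  (forall eps : R, 0 < eps ->
     proximal_subgradient (slice f lb) xb vb /\
     para_hypomonotone f xb vb lb eps r ->
     exists2 eps' : R, 0 < eps' <= eps &
       para_prox_regular f xb vb lb eps' r).
Proof.
split=> eps eps0.
  move=> fr; split; first exact: para_prox_regular_proximal fr.
  exact: para_prox_regular_hypomonotone.
by move=> [prox hypo]; exact: hypomonotone_para_prox_regular.
Qed.
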